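(* Let $F(x,y)=\sqrt{g_{ij}(x)y^iy^j}$ be a positive definite Finsler metric, reducible to a Riemannian metric $g=(g_{ij}(x))$, on a domain $\mathcal U\subset\mathbb R^n$. Then $F$ is projectively flat if and only if there exist functions $\psi_l(x)$ on $\mathcal U$ such that $$\frac{\partial g_{ij}}{\partial x^l}=2\psi_l\,g_{ij}+\psi_i\,g_{jl}+\psi_j\,g_{il}\qquad\text{for all } i,j,l.$$ In this case $P(x,y)=\psi_l(x)y^l$ is the projective factor of $F$.
   Context: On $\mathcal U\subset\mathbb R^n$ (open, convex) let $(x^i,y^i)$ be the canonical coordinates on $T\mathcal U=\mathcal U\times\mathbb R^n$, $\mathcal C=y^i\frac{\partial}{\partial y^i}$ and $S_0=y^i\frac{\partial}{\partial x^i}$ the flat spray. The geodesic spray of a Finsler metric $F$ is the unique vector field $S=y^i\frac{\partial}{\partial x^i}-2G^i\frac{\partial}{\partial y^i}$ on $T\mathcal U\setminus\{0\}$ with $i_S\,dd_JF^2=-dF^2$, where $d_Jf=\frac{\partial f}{\partial y^i}dx^i$. $F$ is projectively flat if its geodesics are straight lines as point sets, i.e. its geodesic spray has the form $S=S_0-2P\mathcal C$ with $P$ $1$-homogeneous in $y$; $P$ is the projective factor of $F$. Equivalently (Hamel), $\delta_{S_0}F=\left\{S_0\left(\frac{\partial F}{\partial y^i}\right)-\frac{\partial F}{\partial x^i}\right\}dx^i=0$, and then $P=\frac{S_0F}{2F}$. *)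

(* Defs.v *)
From HB Require Import structures.
From mathcomp Require Import all_boot all_order all_algebra.
From mathcomp Require Import all_classical all_reals all_analysis.

Set Implicit Arguments.
Unset Strict Implicit.
Unset Printing Implicit Defensive.

Import Order.TTheory GRing.Theory Num.Theory.
Import numFieldNormedType.Exports.

Local Open Scope classical_set_scope.
Local Open Scope ring_scope.

(* On an open subset of a finite-dimensional space, C^k is equivalent to the
   existence and continuity of all iterated directional derivatives of order
   at most k.  Only the values of f near points of A matter when A is open. *)
Fixpoint of_class_C (R : realType) (V W : normedModType R) (k : nat)
    (A : set V) (f : V -> W) : Prop :=
  match k with
  | 0 => forall x, A x -> {for x, continuous f}
  | j.+1 => (forall x, A x -> {for x, continuous f}) /\
            forall v : V, (forall x, A x -> derivable f x v) /\
                          of_class_C j A (fun x => 'D_v f x)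
  end.

Definition smooth_on (R : realType) (V W : normedModType R)
    (A : set V) (f : V -> W) : Prop := forall k, of_class_C k A f.

(* T(R^n) = R^n x R^n with canonical coordinates p = (x, y). *)
Notation tangent R n := ('rV[R]_n * 'rV[R]_n)%type.

Definition slit_tangent (R : realType) (n : nat) (U : set 'rV[R]_n) :
    set (tangent R n) := [set p | U p.1 /\ p.2 != 0].

Definition ddy (R : realType) (n : nat) (i : 'I_n) : tangent R n :=
  (0, delta_mx 0 i).

(* Vector fields, 1-forms and 2-forms are written in the global trivialization
   of T(T(R^n)): a k-form takes a base point and k tangent vectors. *)
Definition liouville (R : realType) (n : nat) (p : tangent R n) : tangent R n :=
  (0, p.2).
Definition flat_spray (R : realType) (n : nat) (p : tangent R n) : tangent R n :=
  (p.2, 0).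

Definition form1 (R : realType) (n : nat) := tangent R n -> tangent R n -> R.
Definition form2 (R : realType) (n : nat) :=
  tangent R n -> tangent R n -> tangent R n -> R.

Definition d_fun (R : realType) (n : nat) (f : tangent R n -> R) : form1 R n :=
  fun p a => 'D_a f p.

(* d_J f = (df/dy^i) dx^i *)
Definition dJ_fun (R : realType) (n : nat) (f : tangent R n -> R) : form1 R n :=
  fun p a => \sum_(i < n) 'D_(ddy R i) f p * a.1 0 i.

(* d w (a, b) = a(w(b)) - b(w(a)) for constant vector fields a and b, whose
   bracket vanishes; there is no factor 1/2. *)
Definition d_form1 (R : realType) (n : nat) (w : form1 R n) : form2 R n :=
  fun p a b => 'D_a (fun q => w q b) p - 'D_b (fun q => w q a) p.

Definition interior_product (R : realType) (n : nat)
    (X : tangent R n -> tangent R n) (w : form2 R n) : form1 R n := fun p b => w p (X p) b.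

Definition finsler_metric (R : realType) (n : nat) (U : set 'rV[R]_n)
    (F : tangent R n -> R) : Prop :=
  [/\ smooth_on (slit_tangent U) F,
      (forall p, slit_tangent U p -> 0 < F p),
      (forall x y (c : R), U x -> 0 < c -> F (x, c *: y) = c * F (x, y)) &
      (forall p, slit_tangent U p -> forall u : 'rV[R]_n, u != 0 ->
        0 < \sum_(i < n) \sum_(j < n)
          2^-1 * 'D_(ddy R i) (fun q => 'D_(ddy R j) (fun q => F q ^+ 2) q) p
            * u 0 i * u 0 j)].

(* The first condition says S = y^i d/dx^i - 2 G^i d/dy^i; the last one is
   i_S d d_J F^2 = - d F^2. *)
Definition geodesic_spray (R : realType) (n : nat) (U : set 'rV[R]_n)
    (F : tangent R n -> R) (S : tangent R n -> tangent R n) : Prop :=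
  [/\ (forall p, slit_tangent U p -> (S p).1 = p.2),
      smooth_on (slit_tangent U) S &
      (forall p, slit_tangent U p -> forall b,
        interior_product S (d_form1 (dJ_fun (fun q => F q ^+ 2))) p b
        = - d_fun (fun q => F q ^+ 2) p b)].

Definition projective_factor (R : realType) (n : nat) (U : set 'rV[R]_n)
    (F P : tangent R n -> R) : Prop :=
  (forall x y (c : R), U x -> y != 0 -> 0 < c ->
     P (x, c *: y) = c * P (x, y)) /\
  geodesic_spray U F
    (fun p => flat_spray p - (2 * P p) *: liouville p).

Definition projectively_flat (R : realType) (n : nat) (U : set 'rV[R]_n)
    (F : tangent R n -> R) : Prop := exists P, projective_factor U F P.

Definition riemannian_metric (R : realType) (n : nat) (U : set 'rV[R]_n)
    (g : 'rV[R]_n -> 'M[R]_n) : Prop :=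
  [/\ (forall i j, smooth_on U (fun x => g x i j)),
      (forall x, U x -> forall i j, g x i j = g x j i) &
      (forall x, U x -> forall u : 'rV[R]_n, u != 0 ->
         0 < \sum_(i < n) \sum_(j < n) g x i j * u 0 i * u 0 j)].

Definition riemannian_norm (R : realType) (n : nat)
    (g : 'rV[R]_n -> 'M[R]_n) (p : tangent R n) : R :=
  Num.sqrt (\sum_(i < n) \sum_(j < n) g p.1 i j * p.2 0 i * p.2 0 j).

Definition partial (R : realType) (n : nat) (l : 'I_n)
    (f : 'rV[R]_n -> R) (x : 'rV[R]_n) : R := 'D_(delta_mx 0 l) f x.

(* Main.v *)
Require Import Defs.
From mathcomp Require Import all_boot all_order all_algebra.
From mathcomp Require Import all_classical all_reals all_analysis.
From mathcomp Require Import ring lra.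

Set Implicit Arguments.
Unset Strict Implicit.
Unset Printing Implicit Defensive.

Import Order.TTheory GRing.Theory Num.Theory.
Import numFieldNormedType.Exports.

Local Open Scope classical_set_scope.
Local Open Scope ring_scope.

(** Fix a point x and write g(v, w) for the metric there and t(u; v, w) for
    the derivative of g(v, w) along u, with v and w constant.  When
    F ^ 2 = g(y, y) and S = S_0 - 2 P C, both sides of
    i_S d d_J F^2 = - d F^2 can be evaluated on a vector (v, z) tangent to
    the tangent bundle at (x, y).  The terms in z cancel because g is symmetric,
    and what remains is, for all v,
      2 t(y; v, y) - t(v; y, y) = 4 P(x, y) g(v, y)
    ([geodesic_equationP]).  So projective flatness is a condition on the
    cubic form t alone, and the problem becomes algebra at each point.

    If t(u; v, w) = 2 psi(u) g(v, w) + psi(v) g(w, u) + psi(w) g(v, u) with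
    psi linear, substitution gives this equation with P(x, y) = psi(y)
    ([spray_equation_projective]).  Conversely, suppose that it holds for some
    P(x, .).  Its left side is quadratic in y, so it obeys the parallelogram
    law; comparing coefficients of g(., u) and g(., v) in that law forces
    P(x, .) to be linear ([spray_equation_scalar]).  The difference between t
    and the cubic form built from psi = P(x, .) then satisfies
    2 s(y; v, y) = s(v; y, y), which says that the Christoffel symbols of s
    vanish, hence s = 0 ([sym_cubic_eq0]).

    Two points are analytic.  The cubic form t is linear in its direction u
    only because g is continuously differentiable ([derive_scalar]); this is
    what allows partial derivatives to determine t.  And the spray built from
    psi has to be smooth, although psi is an arbitrary family of functions:
    taking i = j = l in the equation gives
    psi_l = (d g_ll / d x^l) / (4 g_ll) ([smooth_potential]). *)

(** * Cubic forms and the spray equation at a point *)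

Section ScalarBasics.
Variables (R : realFieldType) (V : lmodType R).
Implicit Type f : V -> R.

Lemma scalar_funD f : scalar f -> forall u v, f (u + v) = f u + f v.
Proof. by move=> lf u v; rewrite -[u]scale1r lf mul1r scale1r. Qed.

Lemma scalar_fun0 f : scalar f -> f 0 = 0.
Proof.
by move=> lf; apply: (addrI (f 0)); rewrite -scalar_funD// !addr0.
Qed.

Lemma scalar_funZ f : scalar f -> forall a u, f (a *: u) = a * f u.
Proof. by move=> lf a u; rewrite -[a *: u]addr0 lf scalar_fun0// addr0. Qed.

End ScalarBasics.

Definition sym_form (R : realFieldType) (V : lmodType R) (g : V -> V -> R) :=
  (forall u v, g u v = g v u) /\ (forall v, scalar (g ^~ v)).

Definition sym_cubic (R : realFieldType) (V : lmodType R)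
    (t : V -> V -> V -> R) :=
  (forall u, sym_form (t u)) /\ (forall v w, scalar (fun u => t u v w)).

Section Algebra.
Variables (R : realFieldType) (V : lmodType R).
Implicit Types (g : V -> V -> R) (t : V -> V -> V -> R) (psi p : V -> R).

Lemma sym_form_linl g : sym_form g ->
  forall a u v w, g (a *: u + v) w = a * g u w + g v w.
Proof. by case=> _ gl a u v w; rewrite gl. Qed.

Lemma sym_form_linr g : sym_form g ->
  forall a u v w, g w (a *: u + v) = a * g w u + g w v.
Proof. by move=> gP a u v w; rewrite !(gP.1 w) sym_form_linl. Qed.

Lemma sym_formDl g : sym_form g -> forall u v w, g (u + v) w = g u w + g v w.
Proof. by move=> gP u v w; exact: scalar_funD (gP.2 w) u v. Qed.

Lemma sym_formDr g : sym_form g -> forall u v w, g w (u + v) = g w u + g w v.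
Proof. by move=> gP u v w; rewrite !(gP.1 w) sym_formDl. Qed.

Lemma sym_cubicB t t' : sym_cubic t -> sym_cubic t' ->
  sym_cubic (fun u v w => t u v w - t' u v w).
Proof.
move=> [tC tl] [tC' tl']; split=> [u|v w].
  split=> [v w|w a v v'].
    by rewrite (tC u).1 (tC' u).1.
  by rewrite !sym_form_linl//; ring.
by move=> a u u'; rewrite tl tl'; ring.
Qed.

(** The value that the equation of the theorem prescribes for the derivative
    of [g v w] along [u]. *)
Definition projective_tensor g psi (u v w : V) : R :=
  2 * psi u * g v w + psi v * g w u + psi w * g v u.

Lemma sym_cubic_projective g psi : sym_form g -> scalar psi ->
  sym_cubic (projective_tensor g psi).
Proof.
move=> gP lpsi; rewrite /projective_tensor; split=> [u|v w].
  split=> [v w|w a v v'].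
    by rewrite (gP.1 w v); ring.
  by rewrite !sym_form_linl // lpsi; ring.
by move=> a u u'; rewrite !sym_form_linr // lpsi; ring.
Qed.

(** Polarizing in [y] gives [t u v w + t w v u = t v u w], the vanishing of
    Christoffel symbols of the first kind.  As for the uniqueness of the
    Levi-Civita connection, adding two permuted copies leaves one term. *)
Lemma sym_cubic_eq0 t : sym_cubic t -> (forall y v, 2 * t y v y = t v y y) ->
  forall u v w, t u v w = 0.
Proof.
move=> [tC tl] h.
have tD u u' v w : t (u + u') v w = t u v w + t u' v w.
  exact: scalar_funD (tl v w) u u'.
have pol u v w : t u v w + t w v u = t v u w.
  have := h (u + w) v.
  rewrite !tD !(sym_formDr (tC _)) !(sym_formDl (tC _)).
  by have := h u v; have := h w v; have := (tC v).1 w u; lra.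
move=> u v w; have := pol w v u; have := pol v w u.
by have := (tC u).1 v w; lra.
Qed.

(** The content at one point of the geodesic equation for the spray
    [S_0 - 2 P C]; see [geodesic_equationP]. *)
Definition spray_equation g t p (y v : V) :=
  2 * t y v y - t v y y = 4 * p y * g v y.

Lemma spray_equation_projective g psi : sym_form g ->
  forall y v, spray_equation g (projective_tensor g psi) psi y v.
Proof.
by move=> gP y v; rewrite /spray_equation /projective_tensor (gP.1 y v); ring.
Qed.

(** [t] and [projective_tensor g psi] solve the same inhomogeneous linear
    equation, so their difference solves the homogeneous one. *)
Lemma projective_tensorP g t psi : sym_form g -> sym_cubic t -> scalar psi ->
  (forall y v, spray_equation g t psi y v) ->
  forall u v w, t u v w = projective_tensor g psi u v w.
Proof.
move=> gP tP lpsi h u v w; apply/eqP; rewrite -subr_eq0; apply/eqP.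
move: u v w; apply: (sym_cubic_eq0 (sym_cubicB tP (sym_cubic_projective gP lpsi))).
move=> y v; have := spray_equation_projective psi gP y v; have := h y v.
by rewrite /spray_equation; lra.
Qed.

(** The left side of the equation is quadratic in [y], so its values at
    [u + v], [u - v], [u] and [v] satisfy the parallelogram law.  On the right
    side the law becomes [g w (a *: u + b *: v) = 0] for all [w], with
    coefficients [a] and [b] whose vanishing is the additivity of [p].  If they
    do not both vanish then [u] and [v] are proportional, and additivity follows
    from homogeneity, which comes from the same quadratic dependence. *)
Lemma spray_equation_scalar g t p : sym_form g ->
  (forall u, u != 0 -> 0 < g u u) -> sym_cubic t -> p 0 = 0 ->
  (forall y v, spray_equation g t p y v) -> scalar p.
Proof.
move=> gP g_gt0 [tC tl] p0 h.
have gZ a u v : g u (a *: v) = a * g u v by rewrite gP.1 (scalar_funZ (gP.2 _)) gP.1.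
have tlZ a u v w : t (a *: u) v w = a * t u v w by exact: scalar_funZ (tl v w) a u.
have trZ a u v w : t u v (a *: w) = a * t u v w.
  by rewrite (tC u).1 (scalar_funZ ((tC u).2 v)) (tC u).1.
have tmZ a u v w : t u (a *: v) w = a * t u v w by rewrite (tC u).1 trZ (tC u).1.
have tDl u u' v w : t (u + u') v w = t u v w + t u' v w.
  exact: scalar_funD (tl v w) u u'.
have pZ a y : p (a *: y) = a * p y.
  have [->|y0] := eqVneq y 0; first by rewrite scaler0 p0 mulr0.
  have [->|a0] := eqVneq a 0; first by rewrite scale0r p0 mul0r.
  have gy0 : g y y != 0 by rewrite gt_eqF// g_gt0.
  have := h (a *: y) y; rewrite /spray_equation tlZ !trZ !tmZ gZ.
  have -> : t y y y = 4 * p y * g y y.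
    by have := h y y; rewrite /spray_equation; lra.
  by move=> ha; apply: (mulIf (mulf_neq0 a0 gy0)); lra.
have pD u v : p (u + v) = p u + p v.
  pose a := p (u + v) + p (u - v) - 2 * p u.
  pose b := p (u + v) - p (u - v) - 2 * p v.
  have gab w : g w (a *: u + b *: v) = 0.
    have := h (u + v) w; have := h (u + -1 *: v) w; have := h u w; have := h v w.
    rewrite /spray_equation !tDl !(sym_formDl (tC _)) !(sym_formDr (tC _)).
    rewrite !(sym_formDr gP) !tlZ !tmZ !trZ !gZ scaleN1r /a /b.
    by have := (tC w).1 u v; lra.
  have ab0 : a *: u + b *: v = 0.
    by apply/eqP; apply: contraT => /g_gt0; rewrite gab ltxx.
  have [a0|a0] := eqVneq a 0.
    have [b0|b0] := eqVneq b 0; first by move: a0 b0; rewrite /a /b; lra.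
    have -> : v = (- (b^-1 * a)) *: u.
      apply: (scalerI b0); rewrite scalerA mulrN mulrA mulfV // mul1r scaleNr.
      by apply/eqP; rewrite -addr_eq0 addrC ab0.
    by rewrite -[X in X + _]scale1r -scalerDl !pZ; ring.
  have -> : u = (- (a^-1 * b)) *: v.
    apply: (scalerI a0); rewrite scalerA mulrN mulrA mulfV // mul1r scaleNr.
    by apply/eqP; rewrite -addr_eq0 ab0.
  by rewrite -[X in _ + X]scale1r -scalerDl !pZ; ring.
by move=> a u v; rewrite pD pZ.
Qed.

End Algebra.

(** * Directional derivatives of C^1 functions *)

Section DirectionalDerivative.
Variables (R : realType) (V : normedModType R).
Implicit Types (f : V -> R) (A : set V).

(** The difference quotients of both sides are the same function of the
    increment. *)
Lemma is_derive_line f (z u : V) (c : R) : derivable f (c *: u + z) u ->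
  is_derive c 1 (fun s : R => f (s *: u + z)) ('D_u f (c *: u + z)).
Proof.
have E :
    (fun h : R => h^-1 *:
      (((fun s : R => f (s *: u + z)) \o shift c) (h *: 1) - f (c *: u + z))) =
    (fun h : R => h^-1 *:
      ((f \o shift (c *: u + z)) (h *: u) - f (c *: u + z))).
  by apply/funext => h /=; rewrite [h *: 1]mulr1 scalerDl addrA.
by move=> df; split; rewrite /derivable /derive E.
Qed.

(** The bound is on [`|c|] because [s] may have either sign. *)
Lemma MVT_line f (z u : V) (s : R) :
  (forall c : R, `|c| <= `|s| -> derivable f (c *: u + z) u) ->
  exists2 c : R, `|c| <= `|s| & f (s *: u + z) - f z = s * 'D_u f (c *: u + z).
Proof.
move=> df; pose phi r := f (r *: u + z); pose dphi r := 'D_u f (r *: u + z).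
have is_d (r : R) : `|r| <= `|s| -> is_derive r 1 phi (dphi r).
  by move=> /df; exact: is_derive_line.
have mvt (a b : R) : a <= b -> (forall r, a <= r <= b -> `|r| <= `|s|) ->
    exists2 c, `|c| <= `|s| & phi b - phi a = dphi c * (b - a).
  move=> ab le_s; have [r||c] := @MVT_segment R phi dphi a b ab.
  - rewrite in_itv /= => /andP[ar rb]; apply/is_d/le_s.
    by rewrite (ltW ar) ltW.
  - apply: derivable_within_continuous => r; rewrite in_itv /= => /le_s/is_d.
    by case.
  - by rewrite in_itv /= => /le_s; exists c.
have -> : f z = phi 0 by rewrite /phi scale0r add0r.
have [s0|s0] := leP 0 s.
  have [r /andP[r0 rs]|c cs e] := mvt 0 s s0; first by rewrite !ger0_norm.
  by exists c => //; rewrite e subr0 mulrC.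
have [r /andP[sr r0]|c cs e] := mvt s 0 (ltW s0).
  by rewrite !ler0_norm ?lerN2 // ltW.
by exists c => //; rewrite -[LHS]opprB e sub0r mulrN opprK mulrC.
Qed.

(** Along [h *: (a *: u + v)] go first by [h *: v], which contributes the
    derivative along [v], and then by [(h * a) *: u].  By the mean value
    theorem the second step contributes [a] times a derivative along [u] at a
    point close to [x], and this derivative is continuous. *)
Lemma derive_scalar A f x : open A -> of_class_C 1 A f -> A x ->
  scalar (fun v => 'D_v f x).
Proof.
move=> oA [_ Cf] Ax a u v /=.
apply: cvg_lim => //.
have dv := (Cf v).1 x Ax.
have -> : (fun h : R => h^-1 *: ((f \o shift x) (h *: (a *: u + v)) - f x)) =
  (fun h : R => h^-1 *: (f ((h * a) *: u + (h *: v + x)) - f (h *: v + x))) +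
  (fun h : R => h^-1 *: ((f \o shift x) (h *: v) - f x)).
  apply/funext => h; rewrite /= fctE /= -scalerDr; congr (_ *: _).
  by rewrite scalerDr scalerA !addrA subrK.
apply: cvgD; last exact: dv.
apply/cvgrPdist_lt => e e0.
have ca : continuous_at x (fun x => 'D_u f x) by exact: (Cf u).2.
have e1 : 0 < e / (`|a| + 1) by rewrite divr_gt0 // ltr_wpDl.
have : \forall y \near x, A y /\ `|'D_u f x - 'D_u f y| < e / (`|a| + 1).
  near=> y; split; near: y; first exact: open_nbhs_nbhs.
  by move/cvgrPdist_lt : ca => /(_ _ e1).
move=> /nbhs_ballP[d /= d0 dA].
(* All points met below lie within |h| (|a| |u| + |v|) of x; adding 1 keeps
   the bound on |h| meaningful when this factor is 0. *)
have k0 : 0 < `|a| * `|u| + `|v| + 1 by rewrite ltr_wpDl // addr_ge0 // mulr_ge0.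
have close (h c : R) : `|h| < d / (`|a| * `|u| + `|v| + 1) -> `|c| <= `|h * a| ->
    ball x d (c *: u + (h *: v + x)).
  move=> hd ch; rewrite -ball_normE /= addrA opprD addrCA subrr addr0 normrN.
  apply: (le_lt_trans (ler_normD _ _)); rewrite !normrZ.
  apply: (@le_lt_trans _ _ (`|h| * (`|a| * `|u| + `|v| + 1))).
    rewrite !mulrDr mulrA -normrM -addrA lerD ?ler_wpM2r //.
    by rewrite lerDl mulr1.
  by rewrite -ltr_pdivlMr.
near=> h.
have hd : `|h| < d / (`|a| * `|u| + `|v| + 1).
  by near: h; apply: dnbhs0_lt; rewrite divr_gt0.
have h0 : h != 0 by near: h; exact: nbhs_dnbhs_neq.
have [c|c ch ->] := @MVT_line f (h *: v + x) u (h * a).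
  by move=> /(close _ _ hd)/dA[Ay _]; exact: (Cf u).1.
rewrite -[_ *: _]/(_ * _) -!mulrA mulKf // -mulrBr normrM.
have [_ lte] := dA _ (close _ _ hd ch).
apply: (le_lt_trans (ler_wpM2l (normr_ge0 a) (ltW lte))).
by rewrite mulrCA gtr_pMr // ltr_pdivrMr ?mul1r ?ltrDl // ltr_wpDl.
Unshelve. all: by end_near. Qed.

End DirectionalDerivative.

(** * Closure properties of the classes C^k *)

Section SmoothCalculus.
Variables (R : realType) (V : normedModType R).
Implicit Types (W : normedModType R) (A B : set V) (k : nat).

Lemma of_class_CW W k A (f : V -> W) : of_class_C k.+1 A f -> of_class_C k A f.
Proof.
elim: k f => [|k IH] f [fc df] //.
by split=> // v; split; [exact: (df v).1|exact: IH (df v).2].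
Qed.

Lemma of_class_C_sub W k A B (f : V -> W) :
  B `<=` A -> of_class_C k A f -> of_class_C k B f.
Proof.
move=> BA; elim: k f => [|k IH] f; first by move=> fc x /BA/fc.
case=> fc df; split=> [x /BA/fc //|v]; split=> [x /BA/(df v).1 //|].
exact: IH (df v).2.
Qed.

Lemma of_class_C_eq W k A (f h : V -> W) : open A ->
  (forall x, A x -> f x = h x) -> of_class_C k A f -> of_class_C k A h.
Proof.
move=> oA; elim: k f h => [|k IH] f h fh.
  move=> fc x Ax; have fx := fc x Ax.
  rewrite /continuous_at /prop_for /= -(fh x Ax); apply: cvg_trans fx.
  apply: near_eq_cvg; near=> y; apply: fh; near: y; exact: open_nbhs_nbhs.
move=> [fc df].
have nfh x : A x -> {near x, f =1 h}.
  by move=> Ax; near=> y; apply: fh; near: y; exact: open_nbhs_nbhs.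
split=> [x Ax|v].
  rewrite /continuous_at /prop_for /= -(fh x Ax); apply: cvg_trans (fc x Ax).
  by apply: near_eq_cvg; exact: nfh.
split=> [x Ax|]; first exact: (near_eq_derivable (nfh x Ax) ((df v).1 x Ax)).
by apply: IH (df v).2 => x Ax; exact/near_eq_derive/nfh.
Unshelve. all: by end_near. Qed.

Lemma smooth_cst W A (c : W) : smooth_on A (cst c).
Proof.
move=> k; elim: k c => [|k IH] c; first by move=> x _; exact: cst_continuous.
split=> [x _|v]; first exact: cst_continuous.
split=> [x _|]; first exact: derivable_cst.
have -> : (fun x => 'D_v (cst c) x) = cst 0 by apply/funext => x; rewrite derive_cst.
exact: IH.
Qed.

Lemma of_class_CD W k A (f h : V -> W) : open A ->
  of_class_C k A f -> of_class_C k A h -> of_class_C k A (fun x => f x + h x).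
Proof.
move=> oA; elim: k f h => [|k IH] f h.
  by move=> fc hc x Ax; apply: continuousD; [exact: fc|exact: hc].
move=> [fc df] [hc dh]; split=> [x Ax|v].
  by apply: continuousD; [exact: fc|exact: hc].
have dfx x : A x -> derivable f x v := (df v).1 x.
have dhx x : A x -> derivable h x v := (dh v).1 x.
split=> [x Ax|]; first exact: derivableD (dfx x Ax) (dhx x Ax).
apply: of_class_C_eq oA _ (IH _ _ (df v).2 (dh v).2) => x Ax.
by rewrite -deriveD //; [exact: dfx|exact: dhx].
Qed.

(** The induction needs the product rule for class [k], applied to [f] and [h]
    themselves as well as to their derivatives. *)
Lemma of_class_CM k A (f h : V -> R) : open A ->
  of_class_C k A f -> of_class_C k A h -> of_class_C k A (fun x => f x * h x).
Proof.
move=> oA; elim: k f h => [|k IH] f h.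
  by move=> fc hc x Ax; apply: continuousM; [exact: fc|exact: hc].
move=> Cf Ch; have [fc df] := Cf; have [hc dh] := Ch; split=> [x Ax|v].
  by apply: continuousM; [exact: fc|exact: hc].
have dfx x : A x -> derivable f x v := (df v).1 x.
have dhx x : A x -> derivable h x v := (dh v).1 x.
split=> [x Ax|]; first exact: derivableM (dfx x Ax) (dhx x Ax).
have Cfdh := IH _ _ (of_class_CW Cf) (dh v).2.
have Chdf := IH _ _ (of_class_CW Ch) (df v).2.
apply: of_class_C_eq oA _ (of_class_CD oA Cfdh Chdf) => x Ax.
by rewrite deriveM //; [exact: dfx|exact: dhx].
Qed.

(** The derivative [- (f ^- 2) 'D_v f] involves [f^-1] itself, which is of
    class [k] by induction. *)
Lemma of_class_CV k A (f : V -> R) : open A -> (forall x, A x -> f x != 0) ->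
  of_class_C k A f -> of_class_C k A (fun x => (f x)^-1).
Proof.
move=> oA f0; elim: k => [|k IH].
  by move=> fc x Ax; apply: continuousV; [exact: f0|exact: fc].
move=> Cf; have [fc df] := Cf; split=> [x Ax|v].
  by apply: continuousV; [exact: f0|exact: fc].
have dfx x : A x -> derivable f x v := (df v).1 x.
split=> [x Ax|]; first by apply: derivableV; [exact: f0|exact: dfx].
have CVf := IH (of_class_CW Cf).
have CN : of_class_C k A (cst (-1 : R)) by exact: smooth_cst.
have CM := of_class_CM oA CN (of_class_CM oA (of_class_CM oA CVf CVf) (df v).2).
apply: of_class_C_eq oA _ CM => x Ax.
rewrite deriveV; [|exact: f0|exact: dfx].
by rewrite -[RHS]/(_ * _) -exprVn expr2 mulN1r mulNr.
Qed.

Lemma of_class_C_sum W k A n (f : 'I_n -> V -> W) : open A ->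
  (forall i, of_class_C k A (f i)) -> of_class_C k A (fun x => \sum_i f i x).
Proof.
move=> oA; elim: n f => [|n IH] f Cf.
  apply: of_class_C_eq oA _ (smooth_cst A 0 k) => x _.
  by rewrite big_ord0.
apply: of_class_C_eq oA _
  (of_class_CD oA (IH _ (fun i => Cf (widen_ord (leqnSn n) i))) (Cf ord_max)).
by move=> x _; rewrite big_ord_recr.
Qed.

Lemma is_derive_scalel W (f : V -> R) (w : W) x v : derivable f x v ->
  is_derive x v (fun z => f z *: w) ('D_v f x *: w).
Proof.
move=> df.
have cv : h^-1 *: (((fun z => f z *: w) \o shift x) (h *: v) - f x *: w)
    @[h --> 0^'] --> 'D_v f x *: w.
  have -> : (fun h : R => h^-1 *:
      (((fun z => f z *: w) \o shift x) (h *: v) - f x *: w)) =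
    (fun h : R => (h^-1 *: ((f \o shift x) (h *: v) - f x)) *: w).
    by apply/funext => h /=; rewrite -scalerBl scalerA.
  by apply: cvgZr_tmp; exact: df.
by split; [apply/cvg_ex; eexists; exact: cv|exact: cvg_lim cv].
Qed.

Lemma of_class_C_scalel W k A (f : V -> R) (w : W) : open A ->
  of_class_C k A f -> of_class_C k A (fun x => f x *: w).
Proof.
move=> oA; elim: k f => [|k IH] f.
  by move=> fc x Ax; apply: cvgZr_tmp; exact: fc.
move=> [fc df]; split=> [x Ax|v]; first by apply: cvgZr_tmp; exact: fc.
have dfx x (Ax : A x) := is_derive_scalel w ((df v).1 x Ax).
split=> [x Ax|]; first by case: (dfx x Ax).
apply: of_class_C_eq oA _ (IH _ (df v).2) => x Ax.
by case: (dfx x Ax).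
Qed.

Lemma is_derive_scalar_fun (f : V -> R) x v :
  scalar f -> is_derive x v f (f v).
Proof.
move=> lf.
have cv : h^-1 *: ((f \o shift x) (h *: v) - f x) @[h --> 0^'] --> f v.
  apply: cvg_near_cst; near=> h => /=.
  rewrite lf addrK -[_ *: _]/(_ * _) mulKf //.
  by near: h; exact: nbhs_dnbhs_neq.
by split; [apply/cvg_ex; eexists; exact: cv|exact: cvg_lim cv].
Unshelve. all: by end_near. Qed.

Lemma smooth_scalar_fun A (f : V -> R) : scalar f -> continuous f -> smooth_on A f.
Proof.
move=> lf cf [|k]; first by move=> x _; exact: cf.
split=> [x _|v]; first exact: cf.
have df x := is_derive_scalar_fun x v lf.
split=> [x _|]; first by case: (df x).
have -> : (fun x => 'D_v f x) = cst (f v) by apply/funext => x; case: (df x).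
exact: smooth_cst.
Qed.

End SmoothCalculus.

Section Projection.
Variables (R : realType) (V W X : normedModType R).

(** Difference quotients of [fun p => f p.1] along [v] are by computation
    those of [f] along [v.1], so that no chain rule is involved. *)
Lemma of_class_C_fst k (A : set V) (f : V -> X) : of_class_C k A f ->
  of_class_C k [set p : V * W | A p.1] (fun p => f p.1).
Proof.
elim: k f => [|k IH] f.
  move=> fc p Ap; apply: (@continuous_comp _ _ _ fst f); last exact: fc.
  exact: cvg_fst.
move=> [fc df]; split=> [p Ap|v].
  apply: (@continuous_comp _ _ _ fst f); last exact: fc.
  exact: cvg_fst.
by split=> [p Ap|]; [exact: (df v.1).1 p.1 Ap|exact: IH (df v.1).2].
Qed.

End Projection.

(** * Forms given by matrices and the derivative of a metric *)

Section Coordinates.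
Variables (R : realFieldType) (n : nat).
Implicit Types (M : 'M[R]_n) (u v w : 'rV[R]_n).

Definition matrix_form M u v : R := \sum_i \sum_j M i j * u 0 i * v 0 j.

Lemma matrix_form_scalarl M v : scalar (fun u => matrix_form M u v).
Proof.
move=> a u u'; rewrite /matrix_form mulr_sumr -big_split; apply: eq_bigr => i _ /=.
rewrite mulr_sumr -big_split; apply: eq_bigr => j _ /=.
by rewrite !mxE; ring.
Qed.

Lemma matrix_form_sym M : (forall i j, M i j = M j i) -> sym_form (matrix_form M).
Proof.
move=> MC; split=> [u v|v]; last exact: matrix_form_scalarl.
rewrite /matrix_form exchange_big; apply: eq_bigr => i _; apply: eq_bigr => j _.
by rewrite MC mulrAC.
Qed.

Lemma matrix_form_delta M i j :
  matrix_form M (delta_mx 0 i) (delta_mx 0 j) = M i j.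
Proof.
rewrite /matrix_form (bigD1 i) //= [X in _ + X]big1 ?addr0 => [|k /negPf ki].
  rewrite (bigD1 j) //= [X in _ + X]big1 ?addr0 => [|k /negPf kj].
    by rewrite !mxE !eqxx !mulr1.
  by rewrite !mxE kj andbF mulr0.
by rewrite big1 // => l _; rewrite !mxE ki andbF mulr0 mul0r.
Qed.

Lemma scalar_sum_delta (f : 'rV[R]_n -> R) u : scalar f ->
  f u = \sum_i f (delta_mx 0 i) * u 0 i.
Proof.
move=> lf; rewrite {1}[u]row_sum_delta.
rewrite (big_morph f (scalar_funD lf) (scalar_fun0 lf)).
by apply: eq_bigr => i _; rewrite (scalar_funZ lf) mulrC.
Qed.

Lemma scalar_ext (f h : 'rV[R]_n -> R) : scalar f -> scalar h ->
  (forall i, f (delta_mx 0 i) = h (delta_mx 0 i)) -> f =1 h.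
Proof.
move=> lf lh fh u; rewrite (scalar_sum_delta u lf) (scalar_sum_delta u lh).
by apply: eq_bigr => i _; rewrite fh.
Qed.

Lemma sym_cubic_ext (t t' : 'rV[R]_n -> 'rV[R]_n -> 'rV[R]_n -> R) :
  sym_cubic t -> sym_cubic t' ->
  (forall l i j, t (delta_mx 0 l) (delta_mx 0 i) (delta_mx 0 j) =
                 t' (delta_mx 0 l) (delta_mx 0 i) (delta_mx 0 j)) ->
  forall u v w, t u v w = t' u v w.
Proof.
move=> [tC tl] [tC' tl'] tt' u v w.
apply: (scalar_ext (tl v w) (tl' v w)) => l.
apply: (scalar_ext ((tC _).2 w) ((tC' _).2 w)) => i.
rewrite (tC _).1 (tC' _).1.
by apply: (scalar_ext ((tC _).2 _) ((tC' _).2 _)) => j; rewrite (tC _).1 (tC' _).1.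
Qed.

End Coordinates.

Section MetricDerivative.
Variables (R : realType) (n : nat) (U : set 'rV[R]_n) (g : 'rV[R]_n -> 'M[R]_n).
Hypotheses (openU : open U) (riemg : riemannian_metric U g).

Definition metric_derivative x u v w :=
  matrix_form (\matrix_(i, j) 'D_u (fun z => g z i j) x) v w.

(** Linearity in [u] is where the metric has to be C^1. *)
Lemma metric_derivative_cubic x : U x -> sym_cubic (metric_derivative x).
Proof.
case: riemg => sg gC _ Ux; split=> [u|v w].
  apply: matrix_form_sym => i j; rewrite !mxE; apply: near_eq_derive.
  by near=> z; apply: gC; near: z; exact: open_nbhs_nbhs.
move=> a u u'; rewrite /metric_derivative /matrix_form mulr_sumr -big_split.
apply: eq_bigr => i _ /=.
rewrite mulr_sumr -big_split; apply: eq_bigr => j _ /=.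
by rewrite !mxE (derive_scalar openU (sg i j 1%N) Ux); ring.
Unshelve. all: by end_near. Qed.

Lemma metric_derivative_delta x i j l :
  metric_derivative x (delta_mx 0 l) (delta_mx 0 i) (delta_mx 0 j) =
  partial l (fun z => g z i j) x.
Proof. by rewrite /metric_derivative matrix_form_delta mxE. Qed.

Lemma metric_form_sym x : U x -> sym_form (matrix_form (g x)).
Proof. by case: riemg => _ gC _ Ux; apply: matrix_form_sym; exact: gC. Qed.

Lemma metric_form_gt0 x : U x -> forall u, u != 0 -> 0 < matrix_form (g x) u u.
Proof. by case: riemg => _ _ g0 Ux u; exact: g0. Qed.

End MetricDerivative.

Section DeriveForms.
Variables (R : realType) (V : normedModType R) (n : nat).
Implicit Types (x v : V).

Lemma is_derive_sum_fun m (f : 'I_m -> V -> R) (df : 'I_m -> R) x v :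
  (forall i, is_derive x v (f i) (df i)) ->
  is_derive x v (fun z => \sum_i f i z) (\sum_i df i).
Proof.
move=> fd; have -> : (fun z => \sum_i f i z) = \sum_i f i.
  by apply/funext => z; rewrite fct_sumE.
exact: is_derive_sum.
Qed.

Lemma is_derive_matrix_form (M : V -> 'M[R]_n) (a b : V -> 'rV[R]_n)
    (dM : 'M[R]_n) (da db : 'rV[R]_n) x v :
  (forall i j, is_derive x v (fun z => M z i j) (dM i j)) ->
  (forall i, is_derive x v (fun z => a z 0 i) (da 0 i)) ->
  (forall i, is_derive x v (fun z => b z 0 i) (db 0 i)) ->
  is_derive x v (fun z => matrix_form (M z) (a z) (b z))
    (matrix_form dM (a x) (b x) + matrix_form (M x) da (b x)
     + matrix_form (M x) (a x) db).
Proof.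
move=> hM ha hb; rewrite /matrix_form -!big_split /=.
apply: is_derive_sum_fun => i; rewrite -!big_split /=.
apply: is_derive_sum_fun => j.
apply: is_derive_eq (is_deriveM (is_deriveM (hM i j) (ha i)) (hb j)) _.
by rewrite fctE -![_ *: _]/(_ * _); ring.
Qed.

End DeriveForms.

Section TangentDerivatives.
Variables (R : realType) (n : nat).
Implicit Types (p a : tangent R n).

(** As in [of_class_C_fst], the difference quotients agree by computation. *)
Lemma is_derive_fst (f : 'rV[R]_n -> R) p a : derivable f p.1 a.1 ->
  is_derive p a (fun q : tangent R n => f q.1) ('D_(a.1) f p.1).
Proof. by move=> df; split. Qed.

Lemma fiber_coord_scalar (i : 'I_n) : scalar (fun q : tangent R n => q.2 0 i).
Proof. by move=> c q q' /=; rewrite !mxE. Qed.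

Lemma is_derive_fiber_coord (i : 'I_n) p a :
  is_derive p a (fun q : tangent R n => q.2 0 i) (a.2 0 i).
Proof. exact: is_derive_scalar_fun (fiber_coord_scalar i). Qed.

Lemma continuous_fiber_coord (i : 'I_n) :
  continuous (fun q : tangent R n => q.2 0 i).
Proof.
move=> p; apply: (@continuous_comp _ _ _ snd (fun y : 'rV[R]_n => y 0 i)).
  exact: cvg_snd.
exact: coord_continuous.
Qed.

End TangentDerivatives.

(** * The geodesic equation of a Riemannian norm *)

Section RiemannianSpray.
Variables (R : realType) (n : nat) (U : set 'rV[R]_n) (g : 'rV[R]_n -> 'M[R]_n).
Hypotheses (openU : open U) (riemg : riemannian_metric U g).
Implicit Types (p a b : tangent R n).

Let open_over : open [set p : tangent R n | U p.1].
Proof. by apply: (@open_comp _ _ fst) => // p _; exact: cvg_fst. Qed.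

Lemma near_over p : U p.1 -> \forall q \near p, U q.1.
Proof. by move=> Up; exact: (open_nbhs_nbhs (conj open_over Up)). Qed.

(** Both sides are [0] on the zero section, so the identity holds on the whole
    preimage of [U], which is open; it can then be differentiated. *)
Lemma sqr_riemannian_norm p : U p.1 ->
  riemannian_norm g p ^+ 2 = matrix_form (g p.1) p.2 p.2.
Proof.
move=> Up; rewrite sqr_sqrtr // -/(matrix_form _ _ _).
have [->|/(metric_form_gt0 riemg Up)/ltW //] := eqVneq p.2 0.
by rewrite (scalar_fun0 (matrix_form_scalarl (g p.1) 0)).
Qed.

Lemma is_derive_metric_entry p a i j : U p.1 ->
  is_derive p a (fun q : tangent R n => g q.1 i j) ('D_(a.1) (fun z => g z i j) p.1).
Proof.
move=> Up; apply: (@is_derive_fst R n (fun z => g z i j)).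
by case: riemg => sg _ _; exact: ((sg i j 1%N).2 a.1).1.
Qed.

Lemma derive_sqr_norm p a : U p.1 ->
  'D_a (fun q => riemannian_norm g q ^+ 2) p =
  metric_derivative g p.1 a.1 p.2 p.2 + 2 * matrix_form (g p.1) a.2 p.2.
Proof.
move=> Up.
rewrite (@near_eq_derive _ _ _ _ (fun q => matrix_form (g q.1) q.2 q.2)); last first.
  by near=> q; apply: sqr_riemannian_norm; near: q; exact: near_over.
have dE := is_derive_matrix_form (dM := \matrix_(i, j) 'D_(a.1) (fun z => g z i j) p.1)
  (M := fun q : tangent R n => g q.1) (a := snd) (b := snd) (da := a.2) (db := a.2)
  (x := p) (v := a).
have [|||_ ->] := dE; rewrite /metric_derivative.
- by move=> i j; rewrite mxE; exact: is_derive_metric_entry.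
- by move=> i; exact: is_derive_fiber_coord.
- by move=> i; exact: is_derive_fiber_coord.
by rewrite ((metric_form_sym riemg Up).1 p.2 a.2); ring.
Unshelve. all: by end_near. Qed.

(** The vertical directions [ddy i] do not move the base point, so the
    derivative of the metric does not appear. *)
Lemma dJ_sqr_norm p b : U p.1 ->
  dJ_fun (fun q => riemannian_norm g q ^+ 2) p b = 2 * matrix_form (g p.1) b.1 p.2.
Proof.
move=> Up; rewrite (scalar_sum_delta b.1 (matrix_form_scalarl (g p.1) p.2)) mulr_sumr.
apply: eq_bigr => i _; rewrite derive_sqr_norm //=.
have [_ tl] := metric_derivative_cubic openU riemg Up.
by rewrite (scalar_fun0 (tl p.2 p.2)) add0r mulrA.
Qed.

Lemma derive_dJ_sqr_norm p a b : U p.1 ->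
  'D_a (fun q => dJ_fun (fun q => riemannian_norm g q ^+ 2) q b) p =
  2 * (metric_derivative g p.1 a.1 b.1 p.2 + matrix_form (g p.1) b.1 a.2).
Proof.
move=> Up.
rewrite (@near_eq_derive _ _ _ _ (fun q => 2 * matrix_form (g q.1) b.1 q.2)); last first.
  by near=> q; apply: dJ_sqr_norm; near: q; exact: near_over.
have dE := is_derive_matrix_form (dM := \matrix_(i, j) 'D_(a.1) (fun z => g z i j) p.1)
  (M := fun q : tangent R n => g q.1) (a := cst b.1) (b := snd) (da := 0) (db := a.2)
  (x := p) (v := a).
have [|||df e] := dE.
- by move=> i j; rewrite mxE; exact: is_derive_metric_entry.
- by move=> i; rewrite mxE; exact: is_derive_cst.
- by move=> i; exact: is_derive_fiber_coord.
have := deriveZ 2 df; rewrite e => {e} e.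
rewrite [LHS]e -[LHS]/(_ * _); congr (_ * _).
by rewrite (scalar_fun0 (matrix_form_scalarl (g p.1) p.2)) addr0.
Unshelve. all: by end_near. Qed.

(** Since [X p] is [(y, - 2 c y)], the equation evaluated at [b] reads
    [2 t(y; b.1, y) - t(b.1; y, y) = 4 c g(b.1, y)] once the terms in [b.2],
    twice [g(b.2, y)] on each side, are cancelled. *)
Lemma geodesic_equationP p (X : tangent R n -> tangent R n) (c : R) : U p.1 ->
  X p = flat_spray p - (2 * c) *: liouville p ->
  (forall b,
    interior_product X (d_form1 (dJ_fun (fun q => riemannian_norm g q ^+ 2))) p b
    = - d_fun (fun q => riemannian_norm g q ^+ 2) p b) <->
  (forall v, spray_equation (matrix_form (g p.1)) (metric_derivative g p.1)
    (fun=> c) p.2 v).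
Proof.
move=> Up Xp.
have gP := metric_form_sym riemg Up.
have X1 : (X p).1 = p.2 by rewrite Xp /= scaler0 subr0.
have X2 : (X p).2 = - (2 * c) *: p.2 by rewrite Xp /= sub0r scaleNr.
have gX v : matrix_form (g p.1) v (X p).2 = - (2 * c) * matrix_form (g p.1) v p.2.
  by rewrite X2 gP.1 (scalar_funZ (gP.2 v)) gP.1.
rewrite /interior_product /d_form1 /d_fun /spray_equation.
split=> [h v|h b].
  have := h (v, 0); rewrite !derive_dJ_sqr_norm // derive_sqr_norm //= X1 gX.
  rewrite (gP.1 _ 0) !(scalar_fun0 (gP.2 _)); lra.
have := h b.1; rewrite !derive_dJ_sqr_norm // derive_sqr_norm // X1 gX.
by have := gP.1 p.2 b.2; lra.
Qed.

(** The spray is a finite sum of scalar functions times constant vectors, which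
    reduces the smoothness of a vector-valued map to that of its coordinates. *)
Lemma smooth_spray (P : tangent R n -> R) (A : set (tangent R n)) : open A ->
  smooth_on A P ->
  smooth_on A (fun p => flat_spray p - (2 * P p) *: liouville p).
Proof.
move=> oA sP k.
have sy i : of_class_C k A (fun p : tangent R n => p.2 0 i).
  apply: smooth_scalar_fun; first exact: fiber_coord_scalar.
  exact: continuous_fiber_coord.
have C2 : of_class_C k A (cst (-2 : R)) by exact: smooth_cst.
have CP := of_class_CM oA C2 (sP k).
have Cx := of_class_C_sum oA (fun i =>
  of_class_C_scalel ((delta_mx 0 i, 0) : tangent R n) oA (sy i)).
have Cy := of_class_C_sum oA (fun i =>
  of_class_C_scalel (ddy R i) oA (of_class_CM oA CP (sy i))).
have CS := of_class_CD oA Cx Cy.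
apply: of_class_C_eq oA _ CS => -[x y] _.
rewrite /flat_spray /liouville /ddy; congr pair => /=.
  rewrite (big_morph fst (fun _ _ => erefl) erefl) /=.
  rewrite (big_morph fst (fun _ _ => erefl) erefl) /=.
  rewrite -row_sum_delta big1 ?scaler0 ?subr0 ?addr0 // => i _.
  by rewrite scaler0.
rewrite (big_morph snd (fun _ _ => erefl) erefl) /=.
rewrite (big_morph snd (fun _ _ => erefl) erefl) /=.
rewrite big1 => [|i _]; last by rewrite scaler0.
rewrite add0r sub0r -scaleNr [X in _ = _ *: X]row_sum_delta scaler_sumr.
by apply: eq_bigr => i _; rewrite scalerA mulNr.
Qed.

Section Potential.
Variable psi : 'I_n -> 'rV[R]_n -> R.
Hypothesis psiP : forall x, U x -> forall i j l : 'I_n,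
  partial l (fun z => g z i j) x =
  2 * psi l x * g x i j + psi i x * g x j l + psi j x * g x i l.

Let form x (v : 'rV[R]_n) := \sum_l psi l x * v 0 l.

Let form_scalar x : scalar (form x).
Proof.
move=> a u v; rewrite /form mulr_sumr -big_split; apply: eq_bigr => l _ /=.
by rewrite !mxE; ring.
Qed.

Let form_delta x l : form x (delta_mx 0 l) = psi l x.
Proof.
rewrite /form (bigD1 l) //= big1 ?addr0 => [|k /negPf kl].
  by rewrite mxE !eqxx mulr1.
by rewrite mxE kl andbF mulr0.
Qed.

(** For [i = j = l] the equation reads [partial l g_ll = 4 psi_l g_ll], and
    [g_ll] is positive. *)
Lemma smooth_potential l : smooth_on U (psi l).
Proof.
case: riemg => sg _ _ k.
have g_gt0 x : U x -> 0 < g x l l.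
  move=> Ux; rewrite -matrix_form_delta; apply: (metric_form_gt0 riemg Ux).
  apply/eqP => /matrixP /(_ 0 l); rewrite !mxE !eqxx => /eqP.
  by rewrite oner_eq0.
have Cc : of_class_C k U (cst (4 : R)) by exact: smooth_cst.
have C4 := of_class_CM openU Cc (sg l l k).
have CV : of_class_C k U (fun x => (4 * g x l l)^-1).
  by apply: of_class_CV openU _ C4 => x /g_gt0 gx; rewrite mulf_neq0 // gt_eqF.
have Cd : of_class_C k U (partial l (fun z => g z l l)).
  exact: ((sg l l k.+1).2 (delta_mx 0 l)).2.
apply: of_class_C_eq openU _ (of_class_CM openU Cd CV) => x Ux.
rewrite psiP //; have := g_gt0 x Ux => gx.
by field; rewrite gt_eqF.
Qed.

Lemma projective_factor_potential :
  projective_factor U (riemannian_norm g)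
    (fun p => \sum_l psi l p.1 * p.2 0 l).
Proof.
split=> [x y c _ _ _|].
  exact: (scalar_funZ (form_scalar x)).
split=> [p _||p [Up y0]].
- by rewrite /= scaler0 subr0.
- move=> k; apply: (@of_class_C_sub _ _ _ _ [set p : tangent R n | U p.1]).
    by move=> p [].
  apply: smooth_spray open_over _ k => k.
  apply: (of_class_C_sum open_over) => l.
  apply: (of_class_CM open_over).
    by apply: of_class_C_fst; exact: smooth_potential.
  apply: smooth_scalar_fun; first exact: fiber_coord_scalar.
  exact: continuous_fiber_coord.
have gP := metric_form_sym riemg Up.
apply/(geodesic_equationP Up erefl) => v.
have tE := sym_cubic_ext (metric_derivative_cubic openU riemg Up)
  (sym_cubic_projective gP (form_scalar p.1)).
rewrite /spray_equation !tE; last 2 first.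
- move=> l i j; rewrite metric_derivative_delta psiP // /projective_tensor.
  by rewrite !form_delta !matrix_form_delta.
- move=> l i j; rewrite metric_derivative_delta psiP // /projective_tensor.
  by rewrite !form_delta !matrix_form_delta.
exact: spray_equation_projective gP _ _.
Qed.

End Potential.

(** The spray equation is known only for nonzero [y], but [P] may take any value
    on the zero section.  It is replaced by [0] there, where the equation is
    trivial, before linearity is applied. *)
Lemma potential_of_projective_factor (P : tangent R n -> R) :
  projective_factor U (riemannian_norm g) P ->
  forall x, U x -> forall i j l : 'I_n,
  partial l (fun z => g z i j) x =
    2 * P (x, delta_mx 0 l) * g x i j + P (x, delta_mx 0 i) * g x j l
    + P (x, delta_mx 0 j) * g x i l.
Proof.
move=> [_ [_ _ geo]] x Ux i j l.
have gP := metric_form_sym riemg Ux.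
have tP := metric_derivative_cubic openU riemg Ux.
pose p (y : 'rV[R]_n) := if y == 0 then 0 else P (x, y).
have sprayp y v : spray_equation (matrix_form (g x)) (metric_derivative g x) p y v.
  rewrite /spray_equation /p; have [->|y0] := eqVneq y 0.
    have t0 u w : metric_derivative g x u w 0 = 0.
      by rewrite (tP.1 u).1 (scalar_fun0 ((tP.1 u).2 w)).
    by rewrite !t0 !mulr0 mul0r subr0.
  exact: ((@geodesic_equationP (x, y) _ _ Ux erefl).1 (geo (x, y) (conj Ux y0)) v).
have p0 : p 0 = 0 by rewrite /p eqxx.
have pl := spray_equation_scalar gP (metric_form_gt0 riemg Ux) tP p0 sprayp.
have pE k : P (x, delta_mx 0 k) = p (delta_mx 0 k).
  rewrite /p ifN //; apply/eqP => /matrixP /(_ 0 k); rewrite !mxE !eqxx => /eqP.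
  by rewrite oner_eq0.
rewrite -metric_derivative_delta (projective_tensorP gP tP pl sprayp).
by rewrite /projective_tensor !matrix_form_delta !pE.
Qed.

End RiemannianSpray.

Theorem lemma4p2 (R : realType) (n : nat) (U : set 'rV[R]_n)
    (g : 'rV[R]_n -> 'M[R]_n)
    (openU : open U) (convexU : convex_set U)
    (riemg : riemannian_metric U g)
    (finslerF : finsler_metric U (riemannian_norm g)) :
  (projectively_flat U (riemannian_norm g) <->
   exists psi : 'I_n -> 'rV[R]_n -> R,
     forall x, U x -> forall i j l : 'I_n,
       partial l (fun z => g z i j) x =
         2 * psi l x * g x i j + psi i x * g x j l + psi j x * g x i l) /\
  (forall psi : 'I_n -> 'rV[R]_n -> R,
     (forall x, U x -> forall i j l : 'I_n,
       partial l (fun z => g z i j) x =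
         2 * psi l x * g x i j + psi i x * g x j l + psi j x * g x i l) ->
     projective_factor U (riemannian_norm g)
       (fun p => \sum_(l < n) psi l p.1 * p.2 0 l)).
Proof.
have factor := projective_factor_potential openU riemg.
split; last exact: factor.
split=> [[P Pfactor]|[psi /factor psiP]]; last by eexists; exact: psiP.
exists (fun l x => P (x, delta_mx 0 l)).
exact: potential_of_projective_factor Pfactor.
Qed.
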